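(* Let $K\in\mathbb{N}$, $L>0$, and let $\mathbf{x}$ be a random vector in $\mathbb{R}^K$ with probability density function $p\colon\mathbb{R}^K\to\mathbb{R}_+$ such that $\Pr(\mathbf{x}\in[0,1]^K)=1$ and $p$ is $L$-Lipschitz on $\mathbb{R}^K$ with respect to the $\ell_1$-norm, i.e. $|p(\mathbf{x})-p(\mathbf{y})|\le L\|\mathbf{x}-\mathbf{y}\|_1$ for all $\mathbf{x},\mathbf{y}\in\mathbb{R}^K$. Let $\mathcal{D}=(\mathbf{x}_1,\dots,\mathbf{x}_N)$ be $N$ i.i.d. copies of $\mathbf{x}$, let $M\in\mathbb{N}$, and define the estimator \[ \hat h(\mathcal{D}) := H(\tilde{\mathbf{y}}) - K\log M, \] where $\tilde{\mathbf{y}}=\Delta_M(\mathbf{y})$, $\mathbf{y}$ is distributed according to the empirical distribution of $\mathcal{D}$ (i.e. $\mathbf{y}=\mathbf{x}_u$ with $u$ uniform on $\{1,\dots,N\}$), $\Delta_M$ acts element-wise by $\Delta_M(x)=\lfloor Mx\rfloor/M$, and $H$ denotes Shannon entropy (computed for the given sample, so $\hat h(\mathcal D)$ is the Shannon entropy of the empirical distribution of the quantized samples minus $K\log M$). Define \[ \eta(K,L):=\frac1K\Big(\frac{2(K+1)!}{L}\Big)^{\frac1{K+1}},\qquad \alpha:=\frac{\sqrt{e^2+4}-e}{2e}. \] If $M\ge\frac{1}{\alpha\,\eta(K,L)}$, then for any $\delta\in(0,1)$, with probability greater than $1-\delta$, \[ \big|\hat h(\mathcal{D})-h(\mathbf{x})\big|\le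 \frac{LK}{2M}\log\big(M\eta(K,L)\big)+\sqrt{\frac2N\log\frac2\delta}\,\log N+\log\Big(1+\frac{M^K-1}{N}\Big). \]
   Context: $h(\mathbf{x})=-\int p\log p\,\mathrm{d}\lambda^K$ is the differential entropy of $\mathbf{x}$. Equivalently, $\hat h(\mathcal D)-\!(-K\log M)$ is $-\sum_j \frac{n_j}{N}\log\frac{n_j}{N}$, where $n_j$ is the number of samples whose element-wise quantization $\Delta_M(\mathbf{x}_i)$ equals the $j$-th grid point. *)

(* Defs.v *)
From HB Require Import structures.
From mathcomp Require Import all_boot all_order all_algebra.
From mathcomp Require Import all_classical all_reals all_analysis.
Set Implicit Arguments. Unset Strict Implicit. Unset Printing Implicit Defensive.
Import Order.TTheory GRing.Theory Num.Theory.
Import numFieldNormedType.Exports.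
Local Open Scope classical_set_scope.
Local Open Scope ring_scope.

Section defs.
Variable R : realType.

(* Integral w.r.t. the K-dimensional Lebesgue measure on K.-tuple R,
   computed as the iterated Lebesgue integral (Fubini/Tonelli). *)
Fixpoint lebK_int (n : nat) : (n.-tuple R -> \bar R) -> \bar R :=
  match n return (n.-tuple R -> \bar R) -> \bar R with
  | 0 => fun f => f [tuple]
  | n'.+1 => fun f =>
      (\int[@lebesgue_measure R]_x lebK_int (fun t : n'.-tuple R => f (cons_tuple x t)))%E
  end.

Definition l1dist (K : nat) (s t : K.-tuple R) : R :=
  \sum_(k < K) `|tnth s k - tnth t k|.

Definition unit_cube (K : nat) : set (K.-tuple R) :=
  [set t | forall k : 'I_K, 0 <= tnth t k <= 1].

Definition is_density {d} {T : measurableType d} (P : probability T R) (K : nat)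
  (X : T -> K.-tuple R) (p : K.-tuple R -> R) : Prop :=
  (forall t, 0 <= p t) /\
  forall A : set (K.-tuple R), measurable A ->
    P (X @^-1` A) = lebK_int (fun t => ((\1_A t : R) * p t)%:E).

(* differential entropy h(x) = - int p log p dlambda^K (with 0 log 0 = 0) *)
Definition diff_entropy (K : nat) (p : K.-tuple R -> R) : \bar R :=
  (- lebK_int (fun t => (p t * ln (p t))%:E))%E.

Definition quantize (K M : nat) (x : K.-tuple R) : K.-tuple R :=
  [tuple (Num.floor (M%:R * tnth x k))%:~R / M%:R | k < K].

Definition emp_entropy (N K : nat) (Q : 'I_N -> K.-tuple R) : R :=
  let cnt v := (#|[set i : 'I_N | Q i == v]|)%:R / N%:R in
  - \sum_(v <- undup [seq Q i | i : 'I_N]) cnt v * ln (cnt v).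

Definition hhat (N K M : nat) (D : 'I_N -> K.-tuple R) : R :=
  emp_entropy (fun i => quantize M (D i)) - K%:R * ln M%:R.

Definition eta_KL (K : nat) (L : R) : R :=
  K%:R^-1 * powR (2 * (K.+1)`!%:R / L) (K.+1%:R^-1).

Definition alpha : R := (Num.sqrt (expR 1 ^+ 2 + 4) - expR 1) / (2 * expR 1).

Definition mutually_independent {d} {T : measurableType d} (P : probability T R)
  (N K : nat) (X : 'I_N -> T -> K.-tuple R) : Prop :=
  forall A : 'I_N -> set (K.-tuple R), (forall i, measurable (A i)) ->
    P (\bigcap_(i in [set: 'I_N]) (X i @^-1` A i)) = (\prod_(i < N) P (X i @^-1` A i))%E.

End defs.
Arguments unit_cube {R} K.

(* Main.v *)
Require Import Defs.
From HB Require Import structures.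
From mathcomp Require Import all_boot all_order all_algebra.
From mathcomp Require Import all_classical all_reals all_analysis.
From mathcomp Require Import measurable_realfun ring lra.
Set Implicit Arguments. Unset Strict Implicit. Unset Printing Implicit Defensive.
Import Order.TTheory GRing.Theory Num.Theory.
Import numFieldNormedType.Exports.
Local Open Scope classical_set_scope.
Local Open Scope ring_scope.

(** Let [q] be the law of the cell of the grid of mesh [1/M] containing [x], [H q]
    its Shannon entropy, and [f] the entropy of the empirical law of the [N]
    sampled cells.  Then [hhat - h] is the sum of three terms.
    - [f - E f]: changing one sample moves [f] by at most [2 ln N / N], so
      McDiarmid's inequality gives the square-root term.
    - [E f - H q], which lies in [[- ln (1 + (M^K - 1) / N), 0]]: by Jensen above, and
      below because the relative entropy of the empirical law with respect to [q]
      is at most [ln (1 + chi2)], with [E chi2 <= (M^K - 1) / N].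
    - [H q - K ln M - h], which lies in [[0, L K / M]]: it is the integral of
      [p ln (p / pbar)], with [pbar] the mean of [p] on the current cell, and
      [p ln (p / pbar) <= p (p - pbar) / pbar] with [p - pbar <= L K / M].
    Since [alpha < exp (-2)], the hypothesis on [M] gives [ln (M eta) > 2], so that
    [L K / M < L K / (2 M) ln (M eta)]; this slack also makes the probability
    estimate strict. *)

(** * Lebesgue measure on tuples *)

Definition box {R : realType} {n : nat} (I : 'I_n -> set R) : set (n.-tuple R) :=
  [set t | forall k, I k (tnth t k)].

Lemma measurable_box (R : realType) (n : nat) (I : 'I_n -> set R) :
  (forall k, measurable (I k)) -> measurable (box I).
Proof.
move=> mI.
rewrite (_ : box I = \bigcap_(k in [set: 'I_n]) ((@tnth n R ^~ k) @^-1` I k)).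
  apply: fin_bigcap_measurable => [|k _]; first exact: finite_finset.
  rewrite -[X in measurable X]setTI.
  exact: (@measurable_tnth _ R n k).
by apply/seteqP; split=> t /= tI k; [move=> _|]; exact: tI.
Qed.

Section cons_measure.
Context {R : realType} {n : nat}.
Variable mu : {sigma_finite_measure set (n.-tuple R) -> \bar R}.

Definition pair_cons (z : measurableTypeR R * n.-tuple R) : n.+1.-tuple R :=
  [the n.+1.-tuple R of z.1 :: z.2].

Lemma measurable_pair_cons : measurable_fun setT pair_cons.
Proof. exact: measurable_cons. Qed.

(** The iterated integral [lebK_int] is a recursion, not an integral against a measure. Transporting
    the product measure along [pair_cons] gives, one dimension at a time, a measure on tuples whose
    integral it is. *)
Definition cons_measure : set (n.+1.-tuple R) -> \bar R :=
  pushforward (@lebesgue_measure R \x mu)%E pair_cons.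

Let cons_measure0 : cons_measure set0 = 0%E.
Proof. by rewrite /cons_measure /pushforward preimage_set0 measure0. Qed.

Let cons_measure_ge0 A : (0 <= cons_measure A)%E.
Proof. exact: (@measure_ge0 _ _ _ (@lebesgue_measure R \x mu)%E). Qed.

Let cons_measure_sigma_additive : semi_sigma_additive cons_measure.
Proof.
exact: (@measure_semi_sigma_additive _ _ _
  (measure_function_pushforward__canonical__measure_function_Measure
     (@lebesgue_measure R \x mu)%E measurable_pair_cons)).
Qed.

HB.instance Definition _ := isMeasure.Build _ _ _ cons_measure
  cons_measure0 cons_measure_ge0 cons_measure_sigma_additive.

Let uncons (t : n.+1.-tuple R) : measurableTypeR R * n.-tuple R := (thead t, [tuple of behead t]).

Let measurable_uncons : measurable_fun setT uncons.
Proof.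
apply/measurable_fun_pairP; split.
  exact: (@measurable_tnth _ R n.+1 ord0).
exact: measurable_behead.
Qed.

Let uncons_cons : cancel pair_cons uncons.
Proof. by move=> [x t]; rewrite /uncons /pair_cons /= theadE; congr pair; apply: val_inj. Qed.

(** Sigma-finiteness lets Fubini and Tonelli be applied again in the next dimension. The exhausting
    sets are the rectangles [F i] times [G i]; as both sequences increase, [maxn] of two indices
    serves both coordinates. *)
Let cons_measure_sigma_finite : sigma_finite setT cons_measure.
Proof.
have /sigma_finiteP[F [FT ndF Foo]] := sigma_finiteT (@lebesgue_measure R).
have /sigma_finiteP[G [GT ndG Goo]] := sigma_finiteT mu.
exists (fun i => uncons @^-1` (F i `*` G i)).
  rewrite -preimage_bigcup (_ : \bigcup_i _ = setT) ?preimage_setT//.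
  rewrite -setXTT FT GT predeqE => -[y t]; split; first by move=> [i _ []/= ? ?]; split; exists i.
  move=> [/= [i _ Fiy] [k _ Gkt]]; exists (maxn i k) => //; split.
  - by move: y Fiy; exact/subsetPset/ndF/leq_maxl.
  - by move: t Gkt; exact/subsetPset/ndG/leq_maxr.
move=> i; have [mF Fi] := Foo i; have [mG Gi] := Goo i; split.
  by rewrite -[X in measurable X]setTI; apply: measurable_uncons => //; exact: measurableX.
rewrite /cons_measure /pushforward -comp_preimage.
rewrite (_ : uncons \o pair_cons = id); last by apply/funext => z; apply: uncons_cons.
by rewrite preimage_id product_measure1E// lte_mul_pinfty// ge0_fin_numE.
Qed.

HB.instance Definition _ := Measure_isSigmaFinite.Build _ _ _ cons_measure
  cons_measure_sigma_finite.

Lemma ge0_integral_cons_measure (f : n.+1.-tuple R -> \bar R) :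
  measurable_fun [set: n.+1.-tuple R] f -> (forall t, (0 <= f t)%E) ->
  (\int[cons_measure]_t f t =
   \int[@lebesgue_measure R]_x \int[mu]_t f (cons_tuple x t))%E.
Proof.
move=> mf f0; rewrite (ge0_integral_pushforward measurable_pair_cons)//.
rewrite preimage_setT fubini_tonelli1//; last by move=> z /=.
exact: measurableT_comp mf measurable_pair_cons.
Qed.

Lemma integral_cons_measure (f : n.+1.-tuple R -> \bar R) :
  cons_measure.-integrable setT f ->
  (\int[cons_measure]_t f t =
   \int[@lebesgue_measure R]_x \int[mu]_t f (cons_tuple x t))%E.
Proof.
move=> intf; have mf := measurable_int _ intf.
have intfc : (@lebesgue_measure R \x mu)%E.-integrable setT (f \o pair_cons).
  apply/integrableP; split; first exact: measurableT_comp mf measurable_pair_cons.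
  have /integrableP[_] := intf.
  rewrite (ge0_integral_pushforward measurable_pair_cons)//.
  exact: measurableT_comp.
rewrite (integral_pushforward measurable_pair_cons)//.
by rewrite preimage_setT -integral12_prod_meas1.
Qed.

Lemma cons_measure_box (I : 'I_n.+1 -> set R) : (forall k, measurable (I k)) ->
  cons_measure (box I) =
  (lebesgue_measure (I ord0) * mu (box (fun k : 'I_n => I (lift ord0 k))))%E.
Proof.
move=> mI; rewrite /cons_measure /pushforward.
rewrite (_ : pair_cons @^-1` box I = I ord0 `*` box (fun k : 'I_n => I (lift ord0 k))).
  rewrite product_measure1E; [by []|exact: (mI ord0)|]; apply: measurable_box => k; exact: mI.
apply/seteqP; split=> [[x t] /= tI|[x t] /= [Ix It] k].
  split; first by have := tI ord0.
  by move=> k; have := tI (lift ord0 k); rewrite tnthS.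
have [j ->|->] := unliftP ord0 k; last by [].
by rewrite tnthS; exact: It.
Qed.

End cons_measure.

Lemma unit_cubeE (R : realType) (n : nat) :
  @unit_cube R n = box (fun=> `[0, 1]%classic).
Proof. by apply/seteqP; split=> t /= tI k; have := tI k; rewrite /= in_itv. Qed.

Lemma measurable_unit_cube (R : realType) (n : nat) : measurable (@unit_cube R n).
Proof. by rewrite unit_cubeE; apply: measurable_box => k; exact: measurable_itv. Qed.

(** Induction on the dimension with [cons_measure]. The first clause is Tonelli; the second is
    Fubini, needed for the entropy integrand because its sign varies, and integrability comes from a
    bound supported on the cube. The third supplies the volumes of small boxes and of cells. *)
Lemma lebK_int_measure (R : realType) (n : nat) :
  exists mu : {sigma_finite_measure set (n.-tuple R) -> \bar R},
  [/\ forall f : n.-tuple R -> \bar R, measurable_fun [set: n.-tuple R] f ->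
        (forall t, (0 <= f t)%E) -> lebK_int f = (\int[mu]_t f t)%E,
      forall (C : R) (f : n.-tuple R -> R), measurable_fun [set: n.-tuple R] f ->
        (forall t, `|f t| <= C * \1_(unit_cube n) t) ->
        lebK_int (fun t => (f t)%:E) = (\int[mu]_t (f t)%:E)%E &
      forall I : 'I_n -> set R, (forall k, measurable (I k)) ->
        mu (box I) = (\prod_(k < n) lebesgue_measure (I k))%E].
Proof.
elim: n => [|n [mu [ge0int bint mubox]]].
  exists (dirac [tuple] : {finite_measure set (0.-tuple R) -> \bar R}); split.
  - move=> f mf f0; rewrite integral_dirac//= diracE mem_set// mul1e//.
  - move=> C f mf f0; rewrite integral_dirac//= ?diracE ?mem_set// ?mul1e//.
    exact/measurable_EFinP.
  - move=> I mI; rewrite big_ord0 /= diracE mem_set//.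
    by move=> [].
have box1 : cons_measure mu (@unit_cube R n.+1) = 1%E.
  rewrite unit_cubeE cons_measure_box; last by move=> k; exact: measurable_itv.
  rewrite mubox; last by move=> k; exact: measurable_itv.
  rewrite big1 ?mule1 => [|k _]; rewrite lebesgue_measure_itv/= lte_fin ltr01 oppr0 adde0//.
exists (cons_measure mu); split.
- move=> f mf f0; rewrite ge0_integral_cons_measure//=.
  apply: eq_integral => x _; apply: ge0int => [|t]; last exact: f0.
  apply: (measurableT_comp mf); apply: measurable_cons => //.
- move=> C f mf fC.
  have intf : (cons_measure mu).-integrable setT (EFin \o f).
    apply: (@le_integrable _ _ _ _ _ measurableT _
      (fun t => (C * \1_(unit_cube n.+1) t)%:E)) => //.
    - exact/measurable_EFinP.
    - by move=> t _ /=; rewrite lee_fin (le_trans (fC t))// ler_norm.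
    - under eq_fun do rewrite EFinM.
      apply: integrableZl => //.
      apply/integrableP; split.
        by apply/measurable_EFinP/measurable_indic; exact: measurable_unit_cube.
      under eq_integral => t _ do rewrite gee0_abs ?lee_fin//.
      rewrite integral_indic//; last exact: measurable_unit_cube.
      by rewrite setIT [X in (X < _)%E]box1 ltry.
  rewrite (integral_cons_measure intf)/=.
  apply: eq_integral => x _.
  have mfx : measurable_fun [set: n.-tuple R] (fun t => f (cons_tuple x t)).
    apply: (measurableT_comp mf); apply: measurable_cons => //.
  (* Evaluation at the origin, a point of the cube. The sign of [C] is what lets the bound pass to
     slices, whose indicator may only be larger. *)
  have C0 : 0 <= C.
    have := fC [tuple 0 | k < n.+1].
    rewrite indicE mem_set ?mulr1 ?(le_trans _)// => [|k].
      exact: le_trans.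
    by rewrite tnth_mktuple lexx ler01.
  apply: (bint C) => // t; apply: (le_trans (fC _)); rewrite ler_wpM2l//.
  rewrite !indicE; have [|] := boolP (_ \in _); last by [].
  rewrite inE => tI; rewrite mem_set// => k.
  by have := tI (lift ord0 k); rewrite tnthS.
- by move=> I mI; rewrite /= cons_measure_box// mubox// big_ord_recl.
Qed.

(** * Entropy of a Lipschitz density and of its quantization *)

Lemma ln_le_subr1 (R : realType) (x : R) : 0 < x -> ln x <= x - 1.
Proof.
move=> x0; have := @le_ln1Dx R (x - 1).
by rewrite (addrC 1) subrK; apply; rewrite ltrBrDr addNr.
Qed.

(** The left side is the tangent at [s] of the convex function [t * ln t]; integrated against a law
    of mean [s], it becomes Jensen's inequality. *)
Lemma mulr_ln_ge (R : realType) (t s : R) : 0 <= t -> 0 < s ->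
  t * ln s + t - s <= t * ln t.
Proof.
rewrite le_eqVlt => /predU1P[<-|t0] s0; first by rewrite !mul0r !add0r oppr_le0 ltW.
have := @ln_le_subr1 R (s / t) (divr_gt0 s0 t0).
rewrite ln_div// -(ler_pM2l t0) mulrBr [t * (s / t - 1)]mulrBr mulr1 mulrCA divff ?gt_eqF// mulr1.
lra.
Qed.

(** This is [ln (t / s) <= t / s - 1] multiplied by [t]; averaged, it bounds a relative entropy by a
    chi-square quantity. *)
Lemma mulr_ln_le (R : realType) (t s : R) : 0 <= t -> 0 < s ->
  t * ln t <= t * ln s + t * (t / s - 1).
Proof.
rewrite le_eqVlt => /predU1P[<-|t0] s0; first by rewrite !mul0r addr0.
have := @ln_le_subr1 R (t / s) (divr_gt0 t0 s0).
rewrite ln_div// -(ler_pM2l t0) mulrBr.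
lra.
Qed.

Lemma normr_mulr_ln_le (R : realType) (t : R) : 0 <= t -> `|t * ln t| <= 1 + t ^+ 2.
Proof.
move=> t0; have := mulr_ln_ge t0 (@ltr01 R); have := mulr_ln_le t0 (@ltr01 R).
rewrite ln1 mulr0 divr1 ler_norml => h1 h2; apply/andP; split.
  by nra.
by nra.
Qed.

(** A Lipschitz [p] is the infimum, over rational points [r], of the measurable functions
    [p r + L * l1dist t r], so each of its strict sublevel sets is a countable union of measurable
    sets. *)
Lemma l1dist_lipschitz_measurable (R : realType) (K : nat) (L : R)
  (p : K.-tuple R -> R) : 0 <= L ->
  (forall s t, `|p s - p t| <= L * l1dist s t) -> measurable_fun [set: K.-tuple R] p.
Proof.
move=> L0 pL.
have ml1 (r : K.-tuple R) : measurable_fun [set: K.-tuple R] (fun t => p r + L * l1dist t r).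
  apply: measurable_funD => //; apply: measurable_funM => //.
  apply: measurable_sum => k; apply: measurableT_comp => //.
  by apply: measurable_funB => //; exact: measurable_tnth.
apply: (measurability _ (RGenInftyO.measurableE R)) => //.
move=> _ [_ [a ->] <-]; rewrite setTI.
pose toR (r : K.-tuple rat) : K.-tuple R := [tuple ratr (tnth r k) | k < K].
rewrite (_ : _ @^-1` _ =
    \bigcup_r [set t : K.-tuple R | p (toR r) + L * l1dist t (toR r) < a]); last first.
  apply/seteqP; split=> [t /=|t [r _ /=]]; rewrite in_itv/=; last first.
    apply: le_lt_trans; rewrite -lerBlDl (le_trans _ (pL _ _))// ler_norm//.
  (* Replacing [t] by a rational point within [e] in each coordinate costs at most [2 * L * K * e],
     which is then below [a - p t]; the [+ 1] keeps the denominator positive when [L = 0]. *)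
  move=> pa; pose e := (a - p t) / (2 * L * K%:R + 1).
  have e0 : 0 < e.
    by rewrite divr_gt0 ?subr_gt0// ltr_pwDr// !mulr_ge0.
  have /choice[r rP] : forall k : 'I_K, exists q : rat, ratr q \in `]tnth t k - e, tnth t k + e[.
    move=> k; apply: rat_in_itvoo; lra.
  exists [tuple r k | k < K] => //=.
  set r' := toR _.
  have lr : l1dist t r' <= K%:R * e.
    rewrite /l1dist (le_trans (ler_sum _ (G := fun=> e) _))//; last first.
      by rewrite sumr_const card_ord mulr_natl.
    move=> k _; have := rP k; rewrite /r' !tnth_mktuple in_itv/= ler_norml; lra.
  have := pL t r'; rewrite ler_norml => /andP[pr _].
  apply: (@le_lt_trans _ _ (p t + 2 * L * l1dist t r')); first by lra.
  apply: (@le_lt_trans _ _ (p t + 2 * L * (K%:R * e))); first by nra.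
  have : e * (2 * L * K%:R + 1) = a - p t.
    by rewrite divfK// gt_eqF// ltr_pwDr// !mulr_ge0.
  lra.
apply: countable_bigcupT_measurable => [|r]; first exact: countableP.
rewrite (_ : [set t | _] =
    (fun t : K.-tuple R => p (toR r) + L * l1dist t (toR r)) @^-1` `]-oo, a[).
  by rewrite -[X in measurable X]setTI; apply: ml1 => //; exact: measurable_itv.
by apply/seteqP; split=> t /=; rewrite in_itv.
Qed.

(** Half-open sides make the cells disjoint and match the floor in [quantize]. They tile [[0, 1)^K]
    only; the upper faces of the cube are left out. *)
Definition cell {R : realType} {K : nat} (M : nat) (j : {ffun 'I_K -> 'I_M}) :
    set (K.-tuple R) :=
  box (fun k => `[(j k)%:R / M%:R, (j k).+1%:R / M%:R[%classic).

Lemma measurable_cell (R : realType) (K M : nat) (j : {ffun 'I_K -> 'I_M}) :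
  measurable (@cell R K M j).
Proof. by apply: measurable_box => k; exact: measurable_itv. Qed.

Lemma cellP (R : realType) (K M : nat) (j : {ffun 'I_K -> 'I_M}) (t : K.-tuple R) :
  cell j t <-> forall k, (j k)%:R <= M%:R * tnth t k < (j k).+1%:R.
Proof.
split=> tj k; have := tj k; have M0 : (0 < M)%N by rewrite (leq_ltn_trans _ (ltn_ord (j k))).
  by rewrite /= in_itv/= ler_pdivrMr ?ltr0n// ltr_pdivlMr ?ltr0n// ![_ * M%:R]mulrC.
by rewrite /= in_itv/= ler_pdivrMr ?ltr0n// ltr_pdivlMr ?ltr0n// ![_ * M%:R]mulrC.
Qed.

Lemma cell_inj (R : realType) (K M : nat) (i j : {ffun 'I_K -> 'I_M}) (t : K.-tuple R) :
  cell i t -> cell j t -> i = j.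
Proof.
move=> /cellP ti /cellP tj; apply/ffunP => k; apply: val_inj => /=.
have /andP[i1 i2] := ti k; have /andP[j1 j2] := tj k.
have := le_lt_trans i1 j2; have := le_lt_trans j1 i2.
by rewrite !ltr_nat !ltnS => ? ?; apply/eqP; rewrite eqn_leq; apply/andP.
Qed.

Lemma cell_cover (R : realType) (K M : nat) (t : K.-tuple R) : (0 < M)%N ->
  (forall k, 0 <= tnth t k < 1) -> exists j : {ffun 'I_K -> 'I_M}, cell j t.
Proof.
move=> M0 t01.
have tM k : (Num.trunc (M%:R * tnth t k) < M)%N.
  have /andP[t0 t1] := t01 k; have Mt0 : 0 <= M%:R * tnth t k by rewrite mulr_ge0.
  have /andP[+ _] := truncn_itv Mt0.
  rewrite -(@ltr_nat R) => /le_lt_trans; apply.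
  by rewrite gtr_pMr// ltr0n.
exists [ffun k => Ordinal (tM k)]; apply/cellP => k; rewrite ffunE/=.
by apply: truncn_itv; rewrite mulr_ge0//; have /andP[] := t01 k.
Qed.

Lemma cell_l1dist (R : realType) (K M : nat) (j : {ffun 'I_K -> 'I_M}) (s t : K.-tuple R) :
  cell j s -> cell j t -> l1dist s t <= K%:R / M%:R.
Proof.
move=> sj tj.
rewrite /l1dist (le_trans (ler_sum _ (G := fun=> M%:R^-1) _))//; last first.
  by rewrite sumr_const card_ord mulr_natl.
move=> k _; have := sj k; have := tj k; rewrite /= !in_itv/= ler_norml.
rewrite -[(j k).+1]addn1 natrD mulrDl mul1r; lra.
Qed.

(** * Entropy of the density, cell by cell *)

Section density.
Context (R : realType) (d : measure_display) (T : measurableType d)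
  (P : probability T R) (K : nat) (L : R) (p : K.-tuple R -> R) (x : T -> K.-tuple R).
Hypotheses (L0 : 0 < L) (mx : measurable_fun setT x)
  (dens : is_density P x p) (Pcube : P (x @^-1` unit_cube K) = 1%E)
  (pL : forall s t, `|p s - p t| <= L * l1dist s t).
Variable mu : {sigma_finite_measure set (K.-tuple R) -> \bar R}.
Hypotheses
  (ge0int : forall f : K.-tuple R -> \bar R, measurable_fun [set: K.-tuple R] f ->
     (forall t, (0 <= f t)%E) -> lebK_int f = (\int[mu]_t f t)%E)
  (bint : forall (C : R) (f : K.-tuple R -> R), measurable_fun [set: K.-tuple R] f ->
     (forall t, `|f t| <= C * \1_(unit_cube K) t) ->
     lebK_int (fun t => (f t)%:E) = (\int[mu]_t (f t)%:E)%E)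
  (mubox : forall I : 'I_K -> set R, (forall k, measurable (I k)) ->
     mu (box I) = (\prod_(k < K) lebesgue_measure (I k))%E).

Let p0 t : 0 <= p t. Proof. by case: dens. Qed.

Let mp : measurable_fun [set: K.-tuple R] p.
Proof. by apply: (l1dist_lipschitz_measurable (ltW L0)). Qed.

Lemma prob_preimage_integral (A : set (K.-tuple R)) : measurable A ->
  P (x @^-1` A) = (\int[mu]_(t in A) (p t)%:E)%E.
Proof.
move=> mA; have [_ ->//] := dens.
rewrite ge0int; last by move=> t; rewrite lee_fin mulr_ge0.
  rewrite [RHS]integral_mkcond; apply: eq_integral => t _.
  by rewrite patchE indicE; case: ifPn => _; rewrite ?mul1r ?mul0r.
by apply/measurable_EFinP; exact: measurable_funM.
Qed.

(** If [p t > 0], the Lipschitz bound keeps [p] above [p t / 2] on a small open box with lower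
    corner [t]. That box misses the cube, hence has probability zero, although its volume [e ^+ K]
    is positive. The upper faces are included, so the half-open cells carry all the mass. *)
Lemma density_eq0 (t : K.-tuple R) (k : 'I_K) :
  ~~ (0 <= tnth t k < 1) -> p t = 0.
Proof.
move=> tk; apply/eqP/contraT => pt0.
have {}pt0 : 0 < p t by rewrite lt_neqAle eq_sym pt0 p0.
(* The first bound limits the drop of [p] on the box to [p t / 2]. The second keeps the [k]-th
   coordinate negative when it starts negative; otherwise it starts at 1 or more, and the open box
   lies strictly beyond 1 whatever [e] is. *)
pose e := Num.min (p t / (2 * L * K.+1%:R)) (if tnth t k < 0 then - tnth t k else 1).
have e0 : 0 < e.
  rewrite lt_min divr_gt0 ?mulr_gt0//=; case: ifPn => [|_]; last exact: ltr01.
  by rewrite oppr_gt0.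
have mB : measurable (box (fun j : 'I_K => `]tnth t j, tnth t j + e[%classic)).
  by apply: measurable_box => j; exact: measurable_itv.
have : P (x @^-1` box (fun j : 'I_K => `]tnth t j, tnth t j + e[%classic)) = 0%E.
  apply: (@subset_measure0 _ _ _ _ _ (x @^-1` (~` unit_cube K))).
  - by rewrite -[X in measurable X]setTI; exact: mx.
  - rewrite -[X in measurable X]setTI; apply: mx => //; apply: measurableC.
    exact: measurable_unit_cube.
  - apply: preimage_subset => s /(_ k) + /(_ k).
    have : e <= (if tnth t k < 0 then - tnth t k else 1) by rewrite ge_min lexx orbT.
    move: tk; rewrite /= in_itv/=; case: ltP => [?|?]; case: ltP => ? //=; lra.
  - have mC : measurable (x @^-1` unit_cube K).
      by rewrite -[X in measurable X]setTI; apply: mx => //; exact: measurable_unit_cube.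
    by rewrite -preimage_setC; apply: (etrans (probability_setC P mC)); rewrite Pcube subee.
rewrite prob_preimage_integral// => pB0.
have muB : mu (box (fun j : 'I_K => `]tnth t j, tnth t j + e[%classic)) = (e ^+ K)%:E.
  rewrite mubox => [|j]; last exact: measurable_itv.
  rewrite (eq_bigr (fun=> e%:E)) => [|j _]; last first.
    by rewrite lebesgue_measure_itv/= lte_fin ltrDl e0 -EFinB addrC addKr.
  by rewrite prodEFin prodr_const card_ord.
have : ((p t / 2 * e ^+ K)%:E <= 0 :> \bar R)%E.
  rewrite -pB0 EFinM -muB -integral_cst//; apply: ge0_le_integral => //.
  - by move=> s _; rewrite /= lee_fin divr_ge0.
  - by apply/measurable_EFinP; apply: measurable_funS mp.
  - move=> s sB; rewrite /= lee_fin.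
    have e1 : e <= p t / (2 * L * K.+1%:R) by rewrite ge_min lexx.
    have l1 : l1dist s t <= K%:R * e.
      rewrite /l1dist (le_trans (ler_sum _ (G := fun=> e) _))//; last first.
        by rewrite sumr_const card_ord mulr_natl.
      by move=> j _; have := sB j; rewrite /= in_itv/= ler_norml; lra.
    have := pL s t; rewrite ler_norml => /andP[+ _].
    have : L * l1dist s t <= L * (K.+1%:R * e).
      by rewrite ler_wpM2l ?(ltW L0)// (le_trans l1)// ler_wpM2r ?ler_nat// ltW.
    have : 2 * L * (K.+1%:R * e) <= p t.
      by rewrite mulrA -ler_pdivlMl ?mulr_gt0// mulrC.
    lra.
by rewrite lee_fin leNgt mulr_gt0 ?divr_gt0 ?exprn_gt0.
Qed.

Hypothesis K0 : (0 < K)%N.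

(** Comparison with the corner [(1, ..., 1)], where [p] vanishes and which lies within l1-distance
    [K] of every point of the cube. *)
Lemma density_le (t : K.-tuple R) : p t <= L * K%:R.
Proof.
have [t01|/existsNP[k /negP tk]] := pselect (forall k, 0 <= tnth t k < 1); last first.
  by rewrite (density_eq0 tk) mulr_ge0// ltW.
pose s : K.-tuple R := [tuple 1 | k < K].
have ps : p s = 0.
  by apply: (@density_eq0 s (Ordinal K0)); rewrite tnth_mktuple ltxx andbF.
have := pL t s; rewrite ps subr0 ger0_norm// => /le_trans; apply.
rewrite ler_pM2l// /l1dist (le_trans (ler_sum _ (G := fun=> 1) _))//; last first.
  by rewrite sumr_const card_ord.
by move=> k _; have := t01 k; rewrite tnth_mktuple ler_norml; lra.
Qed.

Let B := 1 + (L * K%:R) ^+ 2.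

Let entropy_le t : `|p t * ln (p t)| <= B.
Proof.
rewrite (le_trans (normr_mulr_ln_le (p0 t)))// lerD2l ler_sqr ?nnegrE ?density_le//.
by rewrite mulr_ge0// ltW.
Qed.

Let entropy_le_cube t : `|p t * ln (p t)| <= B * \1_(unit_cube K) t.
Proof.
rewrite indicE; have [|] := boolP (_ \in _); first by rewrite mulr1.
rewrite notin_setE => /existsNP[k tk]; rewrite (@density_eq0 t k) ?mul0r ?normr0 ?mulr0//.
by apply/negP => /andP[t0 /ltW t1]; apply: tk; rewrite t0.
Qed.

Let mentropy : measurable_fun [set: K.-tuple R] (fun t => p t * ln (p t)).
Proof. by apply: measurable_funM => //; apply: measurableT_comp. Qed.

Lemma diff_entropy_integral :
  diff_entropy p = (- \int[mu]_t (p t * ln (p t))%:E)%E.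
Proof. by rewrite /diff_entropy (bint mentropy entropy_le_cube). Qed.

Variable M : nat.
Hypothesis M0 : (0 < M)%N.
Local Notation cell := (@cell R K M).
Let q j := fine (P (x @^-1` cell j)).
Let v : R := M%:R^-1 ^+ K.

Let v0 : 0 < v. Proof. by rewrite exprn_gt0// invr_gt0 ltr0n. Qed.

Let mu_cell j : mu (cell j) = v%:E.
Proof.
rewrite mubox => [|k]; last exact: measurable_itv.
rewrite (eq_bigr (fun=> (M%:R^-1)%:E)) => [|k _]; last first.
  rewrite lebesgue_measure_itv/= lte_fin ltr_pM2r ?invr_gt0 ?ltr0n// ltr_nat ltnSn.
  by rewrite -EFinB -mulrBl -natr1 [_ + 1]addrC addrK mul1r.
by rewrite prodEFin prodr_const card_ord.
Qed.

Let mcell j : measurable (cell j). Proof. exact: measurable_cell. Qed.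

Let int_cell j (C : R) (f : K.-tuple R -> R) : measurable_fun [set: K.-tuple R] f ->
  (forall t, `|f t| <= C) -> mu.-integrable (cell j) (EFin \o f).
Proof.
move=> mf fC; apply: measurable_bounded_integrable => //.
- by rewrite [X in (X < _)%E]mu_cell ltry.
- exact: measurable_funS mf.
- exists C; split; first exact: num_real.
  by move=> D /ltW CD t _ /=; exact: le_trans (fC t) CD.
Qed.

Let intp j : mu.-integrable (cell j) (EFin \o p).
Proof. by apply: (int_cell j mp (C := L * K%:R)) => t; rewrite ger0_norm// density_le. Qed.

Let int_cell_p j : \int[mu]_(t in cell j) p t = q j.
Proof.
rewrite /q prob_preimage_integral//.
Qed.

Let int_cell_lin j (a b : R) : mu.-integrable (cell j) (EFin \o (fun t => a * p t + b)) /\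
  \int[mu]_(t in cell j) (a * p t + b) = a * q j + b * v.
Proof.
have inta : mu.-integrable (cell j) (EFin \o (fun t => a * p t)).
  apply: (@eq_integrable _ _ _ mu (cell j) _ (fun t => a%:E * (EFin \o p) t)%E) => //.
  exact: integrableZl.
have intb : mu.-integrable (cell j) (EFin \o (fun=> b)).
  by apply: (int_cell j (C := `|b|)).
split.
  rewrite (_ : EFin \o _ = (EFin \o (fun t => a * p t)) \+ (EFin \o (fun=> b)))//.
  exact: integrableD.
rewrite RintegralD// RintegralZl// int_cell_p Rintegral_cst//.
congr (_ + b * _); exact: (congr1 fine (mu_cell j)).
Qed.

Let h j := \int[mu]_(t in cell j) (p t * ln (p t)).

Let inth j : mu.-integrable (cell j) (EFin \o (fun t => p t * ln (p t))).
Proof. exact: int_cell mentropy entropy_le. Qed.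

Let q_ge0 j : 0 <= q j. Proof. exact: fine_ge0. Qed.

Let h_ge j s : 0 < s -> q j * ln s + q j - s * v <= h j.
Proof.
move=> s0; have [i1 e1] := int_cell_lin j (ln s + 1) (- s).
rewrite (_ : _ - _ = (ln s + 1) * q j + - s * v); last by ring.
rewrite -e1; apply: le_Rintegral => // t _.
have := mulr_ln_ge (p0 t) s0; lra.
Qed.

(** A cell has l1-diameter at most [K / M], so [p t - L * K / M] is a lower bound for [p] on the
    cell; integrating it over the cell, of volume [v], gives the claim. *)
Let p_le j t : cell j t -> p t * v <= q j + L * K%:R / M%:R * v.
Proof.
move=> tj; have [i1 e1] := int_cell_lin j 0 (p t - L * K%:R / M%:R).
rewrite -lerBlDr -mulrBl.
rewrite mul0r add0r in e1; rewrite -e1 -int_cell_p; apply: le_Rintegral => // s sj.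
have := pL t s; rewrite ler_norml => /andP[_].
have : L * l1dist t s <= L * (K%:R / M%:R) by rewrite ler_pM2l//; exact: cell_l1dist tj sj.
lra.
Qed.

(** Both sides come from the pointwise bounds on [t * ln t] taken at the cell mean [s = q j / v],
    for which [ln s = ln (q j) + K * ln M]. *)
Let h_bounds j : q j * ln (q j) + q j * (K%:R * ln M%:R) <= h j <=
  q j * ln (q j) + q j * (K%:R * ln M%:R) + L * K%:R / M%:R * v.
Proof.
have LKM : 0 <= L * K%:R / M%:R * v by rewrite !mulr_ge0 ?invr_ge0// ltW.
have [q0|] := boolP (q j == 0).
  rewrite (eqP q0) !mul0r !add0r; apply/andP; split; last first.
    rewrite (le_trans _ LKM)//.
    have [i1 e1] := int_cell_lin j (L * K%:R) 0.
    rewrite (eqP q0) mul0r mulr0 add0r in e1; rewrite -e1; apply: le_Rintegral => // t _.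
    have := mulr_ln_le (p0 t) (@ltr01 R); rewrite ln1 mulr0 add0r divr1.
    have := density_le t; have := p0 t; nra.
  (* The cell mean is 0 and cannot serve as [s]; the tangent at [e / v] loses exactly [e], which is
     arbitrary. *)
  apply/ler_addgt0Pr => e e0; have := h_ge j (divr_gt0 e0 v0).
  by rewrite (eqP q0) mul0r add0r sub0r divfK ?gt_eqF// lerNl; lra.
rewrite neq_lt ltNge q_ge0/= => q0.
have s0 : 0 < q j / v by rewrite divr_gt0.
have lns : ln (q j / v) = ln (q j) + K%:R * ln M%:R.
  rewrite ln_div// /v lnXn ?invr_gt0 ?ltr0n// lnV ?posrE ?ltr0n//.
  by rewrite mulNrn opprK mulr_natl.
have := h_ge j s0; rewrite lns divfK ?gt_eqF// addrK mulrDr => ->/=.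
(* With [s] the cell mean, [p * (p / s - 1) <= p * (L * K / M) / s] by [p_le], so the integrand is
   bounded by a multiple of [p]. *)
have [i1 e1] := int_cell_lin j (ln (q j / v) + L * K%:R / M%:R * v / q j) 0.
have -> : q j * ln (q j) + q j * (K%:R * ln M%:R) + L * K%:R / M%:R * v =
    (ln (q j / v) + L * K%:R / M%:R * v / q j) * q j + 0 * v.
  by rewrite lns mul0r addr0 mulrDl divfK ?gt_eqF//; ring.
rewrite -e1; apply: le_Rintegral => // t tj.
rewrite (le_trans (mulr_ln_le (p0 t) s0))// addr0 mulrDl [ln _ * _]mulrC lerD2l mulrC.
rewrite ler_wpM2r// invf_div lerBlDr -(ler_pM2r q0) mulrDl divfK ?gt_eqF// mul1r.
by rewrite mulrA divfK ?gt_eqF// addrC p_le.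
Qed.

Let integral_cells (f : K.-tuple R -> R) : measurable_fun [set: K.-tuple R] f ->
  (forall t k, ~~ (0 <= tnth t k < 1) -> f t = 0) ->
  (\int[mu]_t (f t)%:E = \sum_j \int[mu]_(t in cell j) (f t)%:E)%E.
Proof.
move=> mf f0.
rewrite -integral_bigsetU_EFin//=; last 3 first.
- exact: index_enum_uniq.
- by apply/trivIsetP => i j _ _ /eqP ij; apply/disjoints_subset => t /cell_inj ti /ti.
- by apply/measurable_EFinP; apply: measurable_funS mf.
rewrite [RHS]integral_mkcond; apply: eq_integral => t _; rewrite patchE.
case: ifPn => // /negP tD; rewrite (_ : f t = 0)//; apply: contrapT => ft0; apply: tD.
have /(cell_cover M0)[j tj] : forall k, 0 <= tnth t k < 1.
  by move=> k; apply: contrapT => /negP /f0.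
by rewrite inE -bigcup_seq; exists j => //=; rewrite mem_index_enum.
Qed.

(** Sum of [h_bounds] over the cells: the weights [q j] add up to 1, and so do the volumes [v] of
    the [M ^ K] cells, which turns the errors per cell into a single [L * K / M]. *)
Lemma quantized_entropy_bounds :
  \sum_j q j = 1 /\
  exists2 H : R, diff_entropy p = H%:E &
    - \sum_j q j * ln (q j) - K%:R * ln M%:R - L * K%:R / M%:R <= H <=
    - \sum_j q j * ln (q j) - K%:R * ln M%:R.
Proof.
have sumq : \sum_j q j = 1.
  apply: EFin_inj; rewrite -sumEFin.
  transitivity (\sum_j \int[mu]_(t in cell j) (p t)%:E)%E.
    apply: eq_bigr => j _; rewrite /q -prob_preimage_integral// fineK// fin_num_measure//.
    by rewrite -[X in measurable X]setTI; exact: mx.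
  rewrite -integral_cells// => [|t k]; last exact: density_eq0.
  by rewrite -prob_preimage_integral// preimage_setT probability_setT.
split=> //; exists (- \sum_j h j).
  rewrite diff_entropy_integral integral_cells// => [|t k tk]; last first.
    by rewrite (density_eq0 tk) mul0r.
  rewrite EFinN -sumEFin; congr (- _)%E; apply: eq_bigr => j _.
  by rewrite /h /Rintegral fineK//; exact: integrable_fin_num (inth j).
have sumv : \sum_(j : {ffun 'I_K -> 'I_M}) v = 1.
  rewrite sumr_const card_ffun !card_ord -mulr_natl natrX /v -exprMn divff ?expr1n//.
  by rewrite pnatr_eq0 -lt0n.
have sumqM c : \sum_j q j * c = c by rewrite -mulr_suml sumq mul1r.
have sumvM c : \sum_(j : {ffun 'I_K -> 'I_M}) c * v = c by rewrite -mulr_sumr sumv mulr1.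
have h1 : \sum_j q j * ln (q j) + K%:R * ln M%:R <= \sum_j h j.
  rewrite -[K%:R * _]sumqM -big_split/=; apply: ler_sum => j _.
  by have /andP[] := h_bounds j.
have h2 : \sum_j h j <= \sum_j q j * ln (q j) + K%:R * ln M%:R + L * K%:R / M%:R.
  rewrite -[K%:R * _]sumqM -[L * _ / _]sumvM -!big_split/=.
  by apply: ler_sum => j _; have /andP[] := h_bounds j.
lra.
Qed.
End density.

(** * McDiarmid's inequality and the plug-in entropy *)

Lemma ge0_derive_ge0 (R : realType) (f df : R -> R) (u : R) : 0 <= u ->
  (forall x : R, is_derive x 1 f (df x)) -> (forall x, 0 <= x -> 0 <= df x) -> f 0 <= f u.
Proof.
rewrite le_eqVlt => /predU1P[<-//|u0] fdf df0.
have [|c] := MVT u0 (fun x _ => fdf x).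
  by apply: derivable_within_continuous => x _; have [] := fdf x.
rewrite in_itv/= => /andP[c0 _] fE.
by rewrite -subr_ge0 fE mulr_ge0 ?subr_ge0 ?df0 ?ltW.
Qed.

(** This is [tanh (w / 2) <= w / 2]. *)
Lemma expR_sub1_le (R : realType) (w : R) : 0 <= w -> 2 * (expR w - 1) <= w * (expR w + 1).
Proof.
move=> w0.
have := @ge0_derive_ge0 R (fun w => (w - 2) * expR w + w) (fun w => (w - 1) * expR w + 1) w w0.
rewrite expR0 => H; suff : (0 - 2) * 1 + 0 <= (w - 2) * expR w + w by lra.
apply: H => [x|x x0].
  by apply: is_derive_eq; rewrite -!/(_ *: _) /GRing.scale/=; ring.
have := expR_ge1Dx (- x); rewrite expRN => h.
have e0 := expR_gt0 x.
have : (1 + - x) * expR x <= 1 by rewrite -ler_pdivlMr ?div1r.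
lra.
Qed.

(** Hoeffding's bound for a Bernoulli variable. The gap between the logarithms of the two sides
    vanishes at 0, and its first derivative is shown to be nonnegative. *)
Lemma two_point_mgf (R : realType) (th u : R) : 0 <= th <= 1 -> 0 <= u ->
  1 - th + th * expR u <= expR (th * u + u ^+ 2 / 8).
Proof.
move=> /andP[th0 th1] u0.
have pos (x : R) : 0 < 1 - th + th * expR x.
  move: th0; rewrite le_eqVlt => /predU1P[<-|th0]; first by rewrite mul0r subr0 addr0.
  by rewrite addrC ltr_wpDr ?subr_ge0// mulr_gt0 ?expR_gt0.
rewrite -[leLHS]lnK ?posrE// ler_expR -subr_ge0.
have := @ge0_derive_ge0 R (fun x => th * x + x ^+ 2 / 8 - ln (1 - th + th * expR x))
  (fun x => th + x / 4 - th * expR x / (1 - th + th * expR x)) u u0.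
rewrite !mulr0 expR0 mulr1 subrK ln1 expr0n/= mul0r addr0 subrr; apply => [x|x x0].
  have lnx := is_derive1_ln (pos x).
  apply: is_derive_eq; rewrite /GRing.scale/=.
  by field; rewrite gt_eqF.
rewrite subr_ge0 ler_pdivrMr//.
set b := expR (x / 2).
have eb : expR x = b ^+ 2 by rewrite -expRM_natl; congr expR; lra.
have b1 : 1 <= b by rewrite -expR0 ler_expR divr_ge0.
have hb : (b - 1) <= x / 4 * (b + 1).
  have := @expR_sub1_le R (x / 2); rewrite divr_ge0// => /(_ isT).
  rewrite -/b; lra.
rewrite eb -(@ler_pM2r _ (b + 1)); last by lra.
have h1 : (b - 1) * (1 - th + th * b ^+ 2) <= x / 4 * (b + 1) * (1 - th + th * b ^+ 2).
  by rewrite ler_wpM2r// -eb ltW.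
(* With [D = 1 - th + th * b ^+ 2], one has [D - th * (1 - th) * (b + 1) ^+ 2 = (1 - th * (b + 1))
   ^+ 2], while the derivative is [u / 4 - th * (1 - th) * (b ^+ 2 - 1) / D] at the point [u]. *)
have h2 : 0 <= (b - 1) * (1 - th * (b + 1)) ^+ 2 by rewrite mulr_ge0 ?sqr_ge0// subr_ge0.
nra.
Qed.

Section iid_sequences.
Context (R : realType) (J : finType) (q : J -> R).
Hypotheses (q_ge0 : forall j, 0 <= q j) (sum_q : \sum_j q j = 1).

(** By convexity the exponential lies below its chord over the range of [Y], contained in
    [[a, a + c]]. The mean of the chord depends on the mean of [Y] only, and is the moment
    generating function of a two-point law. *)
Lemma hoeffding_lemma (Y : J -> R) (c s : R) : 0 <= s ->
  (forall i j, Y i - Y j <= c) ->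
  \sum_j q j * expR (s * (Y j - \sum_i q i * Y i)) <= expR (s ^+ 2 * c ^+ 2 / 8).
Proof.
move=> s0 Yc.
have [j0 _] : exists j : J, true.
  apply: contrapT => nJ; suff : 0 = 1 :> R by lra.
  by rewrite -sum_q big1// => j; case: nJ; exists j.
have [i0 _ i0P] := @arg_minP _ _ _ j0 xpredT Y isT.
set a := Y i0 in i0P; set m := \sum_i (q i * Y i).
have Yac j : 0 <= Y j - a <= c by rewrite subr_ge0 i0P//= Yc.
have mE : m - a = \sum_j q j * (Y j - a).
  under eq_bigr do rewrite mulrBr.
  by rewrite sumrB -mulr_suml sum_q mul1r.
have c0 : 0 <= c by have /andP[] := Yac j0; apply: le_trans.
have [c00|/eqP cn0] := pselect (c = 0).
  have Ya j : Y j - a = 0 by apply/eqP; rewrite eq_le andbC -{2}c00.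
  have ma : m - a = 0 by rewrite mE big1// => j _; rewrite Ya mulr0.
  rewrite (eq_bigr q) => [|j _]; first by rewrite sum_q c00 expr0n/= mulr0 mul0r expR0.
  by rewrite (_ : Y j - m = 0) ?mulr0 ?expR0 ?mulr1//; have := Ya j; lra.
have {cn0}c0 : 0 < c by rewrite lt_neqAle eq_sym cn0.
pose th := (m - a) / c; pose u := s * c.
have ma0 : 0 <= m - a.
  by rewrite mE sumr_ge0// => j _; rewrite mulr_ge0//; have /andP[] := Yac j.
have th01 : 0 <= th <= 1.
  rewrite divr_ge0 ?(ltW c0)//= ler_pdivrMr// mul1r mE.
  rewrite -[leRHS]mul1r -sum_q mulr_suml; apply: ler_sum => j _.
  by rewrite ler_wpM2l//; have /andP[] := Yac j.
have u0 : 0 <= u by rewrite mulr_ge0 ?(ltW c0).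
have conv (l : R) : 0 <= l <= 1 -> expR (l * u) <= 1 - l + l * expR u.
  move=> /andP[l0 l1].
  have := @convex_expR R (Itv01 l0 l1) u 0.
  by rewrite !convRE/= expR0 mulr0 addr0 mulr1 /unstable.onem; lra.
have step : \sum_j q j * expR (s * (Y j - a)) <= 1 - th + th * expR u.
  apply: (@le_trans _ _ (\sum_j q j * (1 - (Y j - a) / c + (Y j - a) / c * expR u))).
    apply: ler_sum => j _; rewrite ler_wpM2l//.
    have -> : s * (Y j - a) = (Y j - a) / c * u by rewrite /u; field; rewrite gt_eqF.
    apply: conv; have /andP[h1 h2] := Yac j.
    by rewrite divr_ge0 ?(ltW c0)//= ler_pdivrMr// mul1r.
  rewrite (eq_bigr (fun j => q j + q j * (Y j - a) * ((expR u - 1) / c))).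
    rewrite big_split/= -mulr_suml -mE sum_q /th le_eqVlt; apply/orP; left; apply/eqP.
    by field; rewrite gt_eqF.
  by move=> j _; field; rewrite gt_eqF.
rewrite (eq_bigr (fun j => q j * expR (s * (Y j - a)) * expR (- (s * (m - a))))).
  rewrite -mulr_suml expRN ler_pdivrMr ?expR_gt0// -expRD (le_trans step)//.
  rewrite (le_trans (two_point_mgf th01 u0))// ler_expR /th /u le_eqVlt; apply/orP; left.
  by apply/eqP; field; rewrite gt_eqF.
by move=> j _; rewrite -mulrA -expRD; congr (_ * expR _); ring.
Qed.

(** Expectation over [n] independent draws from [q]. The argument of [f] is a sequence of any
    length, so that fixing the first letter leaves a function of the same type and inductions on [n]
    go through. *)
Definition iid_mean (n : nat) (f : seq J -> R) : R :=
  \sum_(t : n.-tuple J) (\prod_(j <- t) q j) * f t.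

Lemma iid_mean0 f : iid_mean 0 f = f [::].
Proof.
rewrite /iid_mean (big_pred1 [tuple]) => [|t]; first by rewrite big_nil mul1r.
by apply/esym/eqP/val_inj; case: t => -[].
Qed.

Lemma iid_meanS n f :
  iid_mean n.+1 f = \sum_j q j * iid_mean n (fun s => f (j :: s)).
Proof.
rewrite /iid_mean; under [RHS]eq_bigr do rewrite mulr_sumr.
rewrite pair_big/= (reindex (fun jt : J * n.-tuple J => cons_tuple jt.1 jt.2))/=.
  by apply: eq_bigr => -[j t] _ /=; rewrite big_cons mulrA.
exists (fun t => (thead t, [tuple of behead t])) => [[j t]|t] _ /=.
  by congr pair; apply: val_inj.
by rewrite [RHS]tuple_eta; apply: val_inj.
Qed.

Lemma iid_weight_ge0 (s : seq J) : 0 <= \prod_(j <- s) q j.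
Proof. by apply: prodr_ge0. Qed.

Lemma eq_iid_mean n f g : (forall s, size s = n -> f s = g s) ->
  iid_mean n f = iid_mean n g.
Proof. by move=> fg; apply: eq_bigr => t _; rewrite fg// size_tuple. Qed.

Lemma le_iid_mean n f g : (forall s, size s = n -> f s <= g s) ->
  iid_mean n f <= iid_mean n g.
Proof.
move=> fg; apply: ler_sum => t _; rewrite ler_wpM2l ?iid_weight_ge0//.
by rewrite fg// size_tuple.
Qed.

Lemma iid_meanD n f g : iid_mean n (fun s => f s + g s) = iid_mean n f + iid_mean n g.
Proof. by rewrite -big_split/=; apply: eq_bigr => t _; rewrite mulrDr. Qed.

Lemma iid_meanZ n a f : iid_mean n (fun s => a * f s) = a * iid_mean n f.
Proof. by rewrite mulr_sumr; apply: eq_bigr => t _; rewrite mulrCA. Qed.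

Lemma iid_meanN n f : iid_mean n (fun s => - f s) = - iid_mean n f.
Proof. by rewrite -mulN1r -iid_meanZ; apply: eq_iid_mean => s _; rewrite mulN1r. Qed.

Lemma iid_mean_sum n (I : finType) (P : pred I) (f : I -> seq J -> R) :
  iid_mean n (fun s => \sum_(i | P i) f i s) = \sum_(i | P i) iid_mean n (f i).
Proof. by rewrite exchange_big/=; apply: eq_bigr => t _; rewrite mulr_sumr. Qed.

Lemma iid_mean_cst n a : iid_mean n (fun=> a) = a.
Proof.
elim: n => [|n IHn]; first by rewrite iid_mean0.
by rewrite iid_meanS; under eq_bigr do rewrite IHn; rewrite -mulr_suml sum_q mul1r.
Qed.

(** Exchanging [i] and [j] makes this one-sided bound two-sided. *)
Definition bounded_differences (n : nat) (c : R) (f : seq J -> R) : Prop :=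
  forall s1 s2 i j, (size (s1 ++ s2)).+1 = n -> f (s1 ++ i :: s2) - f (s1 ++ j :: s2) <= c.

(** The martingale argument as an induction: given the first letter [j], the rest is handled by
    induction around the conditional mean [F j]. This mean itself varies by at most [c], so
    Hoeffding's lemma supplies the remaining factor. *)
Lemma mcdiarmid_mgf n (f : seq J -> R) (c s : R) : 0 <= s ->
  bounded_differences n c f ->
  iid_mean n (fun t => expR (s * (f t - iid_mean n f))) <=
  expR (n%:R * (s ^+ 2 * c ^+ 2 / 8)).
Proof.
move=> s0; elim: n f => [|n IHn] f fc.
  by rewrite !iid_mean0 subrr !mulr0 mul0r.
pose F j := iid_mean n (fun t => f (j :: t)).
have Fc i j : F i - F j <= c.
  rewrite -[leRHS](iid_mean_cst n) -iid_meanN -iid_meanD; apply: le_iid_mean => t tn.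
  by apply: (fc [::] t i j); rewrite /= tn.
set m := iid_mean n.+1 f; rewrite iid_meanS.
have mE : m = \sum_j q j * F j := iid_meanS n f.
apply: (@le_trans _ _ (\sum_j q j * expR (s * (F j - m)) *
    expR (n%:R * (s ^+ 2 * c ^+ 2 / 8)))).
  apply: ler_sum => j _; rewrite -mulrA ler_wpM2l//.
  have fcj : bounded_differences n c (fun t => f (j :: t)).
    by move=> s1 s2 i k sz; apply: (fc (j :: s1) s2 i k); rewrite /= sz.
  have H := IHn _ fcj.
  apply: (@le_trans _ _ (expR (s * (F j - m)) *
      iid_mean n (fun t => expR (s * (f (j :: t) - F j))))); last first.
    by rewrite ler_pM2l ?expR_gt0.
  rewrite -iid_meanZ le_eqVlt; apply/orP; left; apply/eqP/eq_iid_mean => t _.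
  by rewrite -expRD -mulrDr; congr (expR (s * _)); ring.
rewrite -mulr_suml -[n.+1%:R]natr1 mulrDl mul1r addrC expRD ler_pM2r ?expR_gt0//.
by rewrite mE; exact: hoeffding_lemma.
Qed.

(** Chernoff's bound, with [s] left free and optimized in [mcdiarmid_exponent]. *)
Lemma mcdiarmid_upper n (f : seq J -> R) (c s e : R) : 0 <= s ->
  bounded_differences n c f ->
  iid_mean n (fun t => (e <= f t - iid_mean n f)%R%:R) <=
  expR (n%:R * (s ^+ 2 * c ^+ 2 / 8) - s * e).
Proof.
move=> s0 fc; rewrite expRD mulrC.
apply: (@le_trans _ _ (expR (- (s * e)) *
    iid_mean n (fun t => expR (s * (f t - iid_mean n f))))); last first.
  by rewrite ler_pM2l ?expR_gt0//; exact: mcdiarmid_mgf.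
rewrite -iid_meanZ; apply: le_iid_mean => t _; rewrite -expRD.
case: (boolP (e <= _)) => [et|_]; last exact: expR_ge0.
by rewrite -expR0 ler_expR addrC -mulrBr mulr_ge0// subr_ge0.
Qed.

Lemma mcdiarmid_lower n (f : seq J -> R) (c s e : R) : 0 <= s ->
  bounded_differences n c f ->
  iid_mean n (fun t => (e <= iid_mean n f - f t)%R%:R) <=
  expR (n%:R * (s ^+ 2 * c ^+ 2 / 8) - s * e).
Proof.
move=> s0 fc.
have fcN : bounded_differences n c (fun t => - f t).
  by move=> s1 s2 i j sz; rewrite opprK addrC fc.
apply: le_trans (mcdiarmid_upper e s0 fcN); rewrite le_eqVlt; apply/orP; left.
by apply/eqP/eq_iid_mean => t _; rewrite iid_meanN opprK addrC.
Qed.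

(** * Letter counts, and the sensitivity and bias of the plug-in entropy *)

Lemma iid_mean_count n v : iid_mean n (fun s => (count_mem v s)%:R) = n%:R * q v.
Proof.
elim: n => [|n IHn]; first by rewrite iid_mean0 mul0r.
rewrite iid_meanS (eq_bigr (fun j => q j * (j == v)%:R + q j * (n%:R * q v))) => [|j _].
  rewrite big_split/= -mulr_suml sum_q mul1r (bigD1 v)//= eqxx mulr1 big1 => [|j /negPf ->].
    by rewrite addr0 -[n.+1%:R]natr1 mulrDl mul1r addrC.
  by rewrite mulr0.
rewrite -mulrDr -IHn -[in RHS](iid_mean_cst n (j == v)%:R) -iid_meanD; congr (_ * _).
by apply: eq_iid_mean => s _; rewrite natrD.
Qed.

Lemma iid_mean_count_sq n v : iid_mean n (fun s => (count_mem v s)%:R ^+ 2) =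
  n%:R * q v + n%:R * (n%:R - 1) * q v ^+ 2.
Proof.
elim: n => [|n IHn]; first by rewrite iid_mean0 expr0n/= !mul0r addr0.
rewrite iid_meanS (eq_bigr (fun j => q j * (j == v)%:R * (1 + 2 * (n%:R * q v)) +
    q j * (n%:R * q v + n%:R * (n%:R - 1) * q v ^+ 2))) => [|j _].
  rewrite big_split/= -!mulr_suml sum_q mul1r (bigD1 v)//= eqxx mulr1 big1 => [|j /negPf ->].
    by rewrite -[n.+1%:R]natr1; ring.
  by rewrite mulr0.
rewrite -IHn -mulrA -mulrDr; congr (_ * _).
rewrite (eq_iid_mean (g := fun s => (j == v)%:R * (1 + 2 * (count_mem v s)%:R) +
    (count_mem v s)%:R ^+ 2)) => [|s _]; last first.
  by rewrite /= natrD; case: (j == v) => /=; rewrite ?mulr1n ?mulr0n; ring.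
by rewrite iid_meanD iid_meanZ iid_meanD iid_meanZ iid_mean_cst iid_mean_count.
Qed.

Definition plugin_entropy (n : nat) (s : seq J) : R :=
  - \sum_v (count_mem v s)%:R / n%:R * ln ((count_mem v s)%:R / n%:R).

(** The upper bound amounts to [(m - 1) * (ln (m + 1) - ln m) <= ln m] for positive [m]. After
    subtraction of [ln n], with [m < n], the increment lies in [[- ln n, ln n]]. *)
Lemma natr_ln_increment (m : nat) :
  0 <= m.+1%:R * ln (m.+1%:R : R) - m%:R * ln (m%:R : R) <= 2 * ln (m.+1%:R : R).
Proof.
case: m => [|m]; first by rewrite mul1r !mul0r ln1 subr0 mulr0 lexx.
set x := m.+1%:R : R; have x1 : 1 <= x by rewrite ler1n.
have -> : m.+2%:R = x + 1 :> R by rewrite natr1.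
have x0 : 0 < x by rewrite ltr0n.
have lnx0 : 0 <= ln x by rewrite ln_ge0.
have lnxS : ln x <= ln (x + 1) by rewrite ler_ln ?posrE; lra.
apply/andP; split; first by nra.
have h1 : x * (ln (x + 1) - ln x) <= 1.
  rewrite -ln_div ?posrE//; last by lra.
  have y0 : 0 < (x + 1) / x by rewrite divr_gt0//; lra.
  have := ln_le_subr1 y0; rewrite -(ler_pM2l x0) => /le_trans; apply.
  by rewrite le_eqVlt; apply/orP; left; apply/eqP; field; rewrite gt_eqF.
(* concavity of [ln] at [x] between [1] and [x + 1] *)
have h2 : x - 1 <= x * ln x.
  have := ln_le_subr1 (x := x^-1); rewrite invr_gt0 lnV ?posrE// => /(_ x0).
  rewrite -(ler_pM2l x0) mulrBr mulr1 divff ?gt_eqF//; lra.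
have : (x - 1) * (x * (ln (x + 1) - ln x)) <= x - 1.
  by rewrite -[leRHS]mulr1 ler_wpM2l// subr_ge0.
rewrite mulrCA => h3.
have : (x - 1) * (ln (x + 1) - ln x) <= ln x.
  by rewrite -(ler_pM2l x0) (le_trans h3).
lra.
Qed.

Lemma plugin_entropy_bounded_differences n : (0 < n)%N ->
  bounded_differences n (2 * ln n%:R / n%:R) (plugin_entropy n).
Proof.
move=> n0 s1 s2 i j sz; have n0R : 0 < n%:R :> R by rewrite ltr0n.
pose phi (m : nat) : R := m%:R / n%:R * ln (m%:R / n%:R).
pose D m := phi m.+1 - phi m.
have phiE m : phi m = (m%:R * ln m%:R - m%:R * ln n%:R) / n%:R.
  rewrite /phi; case: m => [|m]; first by rewrite !mul0r subrr mul0r.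
  by rewrite ln_div ?posrE ?ltr0n//; ring.
(* The common letters [s1 ++ s2] contribute a fixed amount, and the letter [k] one increment of
   [phi], of absolute value at most [ln n / n]. Exchanging one letter for another thus costs at most
   twice that. *)
have split_sum k : plugin_entropy n (s1 ++ k :: s2) =
    - (\sum_v phi (count_mem v (s1 ++ s2))) - D (count_mem k (s1 ++ s2)).
  rewrite /plugin_entropy -opprD (bigD1 k)//= [in RHS](bigD1 k)//=.
  rewrite -/(phi _) !count_cat/= eqxx addnCA add1n -!count_cat.
  rewrite (eq_bigr (fun v => phi (count_mem v (s1 ++ s2)))) => [|v /negPf vk].
    by congr (- _); rewrite /D; ring.
  by rewrite -/(phi _) !count_cat/= eq_sym vk.
have Dbound k : - (ln n%:R / n%:R) <= D (count_mem k (s1 ++ s2)) <= ln n%:R / n%:R.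
  set m := count_mem _ _; have mn : (m.+1 <= n)%N by rewrite -sz ltnS count_size.
  have -> : D m = (m.+1%:R * ln m.+1%:R - m%:R * ln m%:R - ln n%:R) / n%:R.
    rewrite /D !phiE -mulrBl; congr (_ / _); rewrite -[m.+1%:R * ln n%:R]/((m.+1)%:R * _).
    by rewrite -[in m.+1%:R * ln n%:R]natr1; ring.
  have : ln m.+1%:R <= ln n%:R :> R by rewrite ler_ln ?posrE ?ltr0n// ler_nat.
  have /andP[h1 h2] := natr_ln_increment m.
  by rewrite -mulNr !ler_pM2r ?invr_gt0//; lra.
rewrite !split_sum; have := Dbound i; have := Dbound j.
rewrite -mulrA; lra.
Qed.

(** Jensen's inequality through the tangent at [q v], which is the mean of the frequency of [v]. *)
Lemma plugin_entropy_mean_le n : (0 < n)%N ->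
  iid_mean n (plugin_entropy n) <= - \sum_v q v * ln (q v).
Proof.
move=> n0; have n0R : 0 < n%:R :> R by rewrite ltr0n.
rewrite iid_meanN iid_mean_sum lerN2; apply: ler_sum => v _.
have mean_freq : iid_mean n (fun s => (count_mem v s)%:R / n%:R) = q v.
  rewrite (eq_iid_mean (g := fun s => n%:R^-1 * (count_mem v s)%:R)) => [|s _]; last exact: mulrC.
  by rewrite iid_meanZ iid_mean_count mulKf ?gt_eqF.
have := q_ge0 v; rewrite le_eqVlt => /predU1P[qv0|qv0].
  (* then [v] has frequency 0 almost surely; frequencies are at least [1 / n] when nonzero *)
  rewrite -qv0 mul0r -[leLHS](mulr0 (- ln n%:R)) [X in _ * X]qv0 -mean_freq -iid_meanZ.
  apply: le_iid_mean => s sn; rewrite [leLHS]mulrC.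
  case: (count_mem v s) => [|m]; first by rewrite !mul0r.
  rewrite ler_pM2l ?divr_gt0 ?ltr0n// ln_div ?posrE ?ltr0n// lerBrDr addNr.
  by rewrite ln_ge0// ler1n.
apply: (@le_trans _ _ (iid_mean n
    (fun s => (ln (q v) + 1) * ((count_mem v s)%:R / n%:R) + - q v))).
  by rewrite iid_meanD iid_meanZ iid_mean_cst mean_freq; lra.
apply: le_iid_mean => s _; set y := _ / _.
have y0 : 0 <= y by rewrite divr_ge0.
by have := mulr_ln_ge y0 qv0; lra.
Qed.

Lemma plugin_entropy_mean_ge n : (0 < n)%N ->
  - \sum_v q v * ln (q v) - ln (1 + (#|J|%:R - 1) / n%:R) <= iid_mean n (plugin_entropy n).
Proof.
move=> n0; have n0R : 0 < n%:R :> R by rewrite ltr0n.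
have mean_freq v : iid_mean n (fun s => (count_mem v s)%:R / n%:R) = q v.
  rewrite (eq_iid_mean (g := fun s => n%:R^-1 * (count_mem v s)%:R)) => [|s _]; last exact: mulrC.
  by rewrite iid_meanZ iid_mean_count mulKf ?gt_eqF.
have mean_freq_sq v : iid_mean n (fun s => ((count_mem v s)%:R / n%:R) ^+ 2) =
    q v * ((1 - q v) / n%:R + q v).
  rewrite (eq_iid_mean (g := fun s => n%:R^-1 ^+ 2 * (count_mem v s)%:R ^+ 2)) => [|s _].
    by rewrite iid_meanZ iid_mean_count_sq; field; rewrite gt_eqF.
  by rewrite exprMn mulrC.
have J1 : 1 <= #|J|%:R :> R.
  rewrite ler1n lt0n; apply/eqP => /card0_eq J0.
  by have := sum_q; rewrite big_pred0// => /eqP; rewrite eq_sym oner_eq0.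
set c := 1 + _; have c1 : 1 <= c by rewrite lerDl divr_ge0 ?subr_ge0// ltW.
have c0 : 0 < c by apply: lt_le_trans c1.
rewrite iid_meanN iid_mean_sum -opprD lerN2.
(* [ln (y / q) <= y / (q * c) - 1 + ln c], so the chi-square divergence bounds the bias *)
have step v : iid_mean n (fun s => (count_mem v s)%:R / n%:R * ln ((count_mem v s)%:R / n%:R)) <=
    q v * ln (q v) + ((1 - q v) / n%:R + q v) / c + q v * (ln c - 1).
  have := q_ge0 v; rewrite le_eqVlt => /predU1P[qv0|qv0].
    rewrite -qv0 !mul0r add0r !addr0 subr0 mul1r.
    apply: (@le_trans _ _ 0); last by rewrite divr_ge0 ?invr_ge0 ?ltW.
    rewrite -(iid_mean_cst n 0); apply: le_iid_mean => s sn.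
    rewrite mulr_ge0_le0// ln_le0// ler_pdivrMr// mul1r ler_nat -sn; exact: count_size.
  apply: (@le_trans _ _ (iid_mean n (fun s =>
      (ln (q v) + ln c - 1) * ((count_mem v s)%:R / n%:R) +
      (q v * c)^-1 * ((count_mem v s)%:R / n%:R) ^+ 2))); last first.
    rewrite iid_meanD !iid_meanZ mean_freq mean_freq_sq le_eqVlt; apply/orP; left.
    by apply/eqP; field; rewrite !gt_eqF.
  apply: le_iid_mean => s _; set y := _ / _; have y0 : 0 <= y by rewrite divr_ge0.
  have := mulr_ln_le y0 (mulr_gt0 qv0 c0); rewrite [ln (q v * c)]lnM ?posrE//.
  by move=> /le_trans; apply; rewrite invfM; lra.
(* The terms [(1 - q v) / n + q v] sum to exactly [c]; divided by [c] they cancel the [- 1], and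
   only [ln c] is left. *)
rewrite (le_trans (ler_sum _ (fun v _ => step v)))// !big_split/= -!mulr_suml big_split/=.
rewrite -mulr_suml sumrB sumr_const sum_q -/(#|J|%:R) addrC.
have -> : (#|J|%:R - 1) / n%:R + 1 = c by rewrite addrC.
rewrite divff ?gt_eqF//; lra.
Qed.

End iid_sequences.

(** * The estimator *)

Lemma sum_undup_count (V : nmodType) (I : eqType) (s : seq I) (F : I -> V) :
  \sum_(v <- undup s) F v *+ count_mem v s = \sum_(v <- s) F v.
Proof.
exact: (big_undup_iterop_count _ s xpredT F).
Qed.

(** Averaging over samples instead of over distinct values leaves an expression in the coincidences
    [Q i' == Q i] alone. It is visibly measurable and directly comparable with [plugin_entropyE]. *)
Lemma emp_entropyE (R : realType) (N K : nat) (Q : 'I_N -> K.-tuple R) :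
  emp_entropy Q =
  - (N%:R^-1 * \sum_(i < N) ln (\sum_(i' < N) (Q i' == Q i)%:R / N%:R)).
Proof.
pose G v : R := ln (\sum_(i' < N) (Q i' == v)%:R / N%:R).
have cardE v : #|[set i : 'I_N | Q i == v]| = count_mem v [seq Q i | i : 'I_N].
  rewrite -sum1_card -sum1_count big_map big_enum_cond/=.
  by apply: eq_bigl => i; apply/idP/idP; rewrite inE.
have cntE v : \sum_(i' < N) (Q i' == v)%:R = #|[set i : 'I_N | Q i == v]|%:R :> R.
  rewrite cardE -sum1_count big_map big_enum_cond/= -natr_sum [in RHS]big_mkcond/=.
  by congr (_%:R); apply: eq_bigr => i _; case: eqP.
rewrite /emp_entropy; congr (- _).
transitivity (N%:R^-1 * \sum_(v <- [seq Q i | i : 'I_N]) G v); last first.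
  by rewrite big_map big_enum.
rewrite -(sum_undup_count _ G) mulr_sumr; apply: eq_bigr => v _.
by rewrite -[G v *+ _]mulr_natl -cardE /G -mulr_suml cntE mulrA [N%:R^-1 * _]mulrC.
Qed.

Lemma plugin_entropyE (R : realType) (J : finType) (N : nat) (t : N.-tuple J) :
  plugin_entropy R N t =
  - (N%:R^-1 * \sum_(i < N) ln (\sum_(i' < N) (tnth t i' == tnth t i)%:R / N%:R)).
Proof.
pose G v : R := ln (\sum_(i' < N) (tnth t i' == v)%:R / N%:R).
have cntE v : \sum_(i' < N) (tnth t i' == v)%:R = (count_mem v t)%:R :> R.
  by rewrite -sum1_count big_tuple -natr_sum [in RHS]big_mkcond/=; congr (_%:R).
rewrite /plugin_entropy; congr (- _).
transitivity (N%:R^-1 * \sum_(v <- t) G v); last by rewrite big_tuple.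
transitivity (N%:R^-1 * \sum_v G v *+ count_mem v t).
  rewrite mulr_sumr; apply: eq_bigr => v _.
  by rewrite -[G v *+ _]mulr_natl /G -mulr_suml cntE mulrA [N%:R^-1 * _]mulrC.
congr (_ * _); rewrite -(sum_undup_count _ G) [LHS](bigID (mem (undup t)))/=.
rewrite [X in _ + X]big1 ?addr0 => [|v]; last first.
  by rewrite mem_undup => /count_memPn ->; rewrite mulr0n.
by rewrite big_uniq ?undup_uniq.
Qed.

Lemma quantize_cell (R : realType) (K M : nat) (j : {ffun 'I_K -> 'I_M}) (x : K.-tuple R) :
  cell j x -> quantize M x = [tuple (j k)%:R / M%:R | k < K].
Proof.
move=> /cellP xj; apply: eq_from_tnth => k; rewrite !tnth_mktuple; congr (_ / _).
have -> // : Num.floor (M%:R * tnth x k) = (j k : nat)%:Z.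
by apply/floor_def; rewrite intrD; have := xj k; rewrite -[(j k).+1%:R]natr1.
Qed.

(** Both entropies depend only on which samples coincide, and two samples have the same quantization
    exactly when their cells are equal. *)
Lemma emp_entropy_cells (R : realType) (N K M : nat) (t : N.-tuple {ffun 'I_K -> 'I_M})
  (D : 'I_N -> K.-tuple R) : (0 < M)%N -> (forall i, cell (tnth t i) (D i)) ->
  emp_entropy (fun i => quantize M (D i)) = plugin_entropy R N t.
Proof.
move=> M0 Dt; rewrite emp_entropyE plugin_entropyE; congr (- (_ * _)).
apply: eq_bigr => i _; congr ln; apply: eq_bigr => i' _; congr (_ %:R / _).
congr nat_of_bool; rewrite !(quantize_cell (Dt _)).
apply/eqP/eqP => [E|->//]; apply/ffunP => k; apply/val_inj/eqP.
have := congr1 (fun s => tnth s k) E; rewrite !tnth_mktuple.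
by move/(mulIf _); rewrite invr_eq0 pnatr_eq0 -lt0n => /(_ M0)/eqP; rewrite eqr_nat.
Qed.

Lemma measurable_quantize_eq (R : realType) (d : measure_display) (T : measurableType d)
  (K M : nat) (X Y : T -> K.-tuple R) :
  measurable_fun setT X -> measurable_fun setT Y ->
  measurable [set w | quantize M (X w) == quantize M (Y w)].
Proof.
move=> mX mY.
have mfl : measurable_fun [set: R] (fun r : R => (Num.floor r)%:~R / M%:R : R).
  apply: measurable_funM => //; apply: nondecreasing_measurable => //.
  by move=> a b ab; rewrite ler_int; exact: le_floor.
have mq (Z : T -> K.-tuple R) k : measurable_fun setT Z ->
    measurable_fun setT (fun w => tnth (quantize M (Z w)) k).
  move=> mZ; under eq_fun do rewrite tnth_mktuple.
  apply: (measurableT_comp mfl); apply: measurable_funM => //.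
  by apply: (measurableT_comp (@measurable_tnth _ R K k)).
rewrite (_ : [set w | _] = \bigcap_(k in [set: 'I_K])
    [set w | tnth (quantize M (X w)) k == tnth (quantize M (Y w)) k]); last first.
  apply/seteqP; split=> [w /eqP XY k _|w XY]; first by apply/eqP; rewrite XY.
  by apply/eqP/eq_from_tnth => k; apply/eqP; exact: XY.
apply: fin_bigcap_measurable => [|k _]; first exact: finite_finset.
have := measurable_fun_eqr (mq _ k mX) (mq _ k mY).
move=> /(_ measurableT [set true] I); rewrite setTI.
by congr measurable; apply/seteqP; split=> w.
Qed.

Lemma measurable_hhat (R : realType) (d : measure_display) (T : measurableType d)
  (N K M : nat) (X : 'I_N -> T -> K.-tuple R) :
  (forall i, measurable_fun setT (X i)) ->
  measurable_fun setT (fun w => hhat M (fun i => X i w)).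
Proof.
move=> mX; rewrite /hhat; apply: measurable_funB => //.
under eq_fun do rewrite emp_entropyE.
apply: measurable_funN; apply: measurable_funM => //.
apply: measurable_sum => i; apply: (measurableT_comp (@measurable_ln R)).
apply: measurable_sum => i'; apply: measurable_funM => //.
rewrite (_ : (fun w => _) = \1_[set w | quantize M (X i' w) == quantize M (X i w)]).
  by apply: measurable_indic; exact: measurable_quantize_eq.
apply/funext => w; rewrite indicE; congr (nat_of_bool _)%:R.
by apply/idP/idP; rewrite inE.
Qed.

(** The square of [e + 2 / e] exceeds [e ^+ 2 + 4], hence [alpha * e ^+ 2 < 1], and the hypothesis
    makes [M * eta] at least [1 / alpha]. *)
Lemma alpha_eta_ln_gt2 (R : realType) (K M : nat) (L : R) : (0 < K)%N -> 0 < L ->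
  (alpha R * eta_KL K L)^-1 <= M%:R -> 2 < ln (M%:R * eta_KL K L).
Proof.
move=> K0 L0.
have eta0 : 0 < eta_KL K L.
  by rewrite mulr_gt0 ?invr_gt0 ?ltr0n// powR_gt0// divr_gt0// mulr_gt0// ltr0n fact_gt0.
set e : R := expR 1; have e0 : 0 < e := expR_gt0 1.
have a0 : 0 < alpha R.
  rewrite divr_gt0 ?mulr_gt0// subr_gt0 -[ltLHS]ger0_norm ?ltW// -sqrtr_sqr.
  by rewrite ltr_sqrt ?ltrDl// ltr_pwDr// sqr_ge0.
have ae : alpha R * e ^+ 2 < 1.
  have : Num.sqrt (e ^+ 2 + 4) < e + 2 / e.
    have h0 : 0 < e + 2 / e by rewrite addr_gt0// divr_gt0.
    rewrite -[ltRHS]ger0_norm ?ltW// -sqrtr_sqr ltr_sqrt ?exprn_gt0//.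
    have -> : (e + 2 / e) ^+ 2 = e ^+ 2 + 4 + (2 / e) ^+ 2 by field; rewrite gt_eqF.
    by rewrite ltrDl exprn_gt0// divr_gt0.
  rewrite -ltrBlDl ltr_pdivlMr// => h.
  have -> : alpha R * e ^+ 2 = (Num.sqrt (e ^+ 2 + 4) - e) * e / 2.
    by rewrite /alpha -/e; field; rewrite gt_eqF.
  by rewrite ltr_pdivrMr// mul1r.
move=> aM.
have M1 : 1 <= alpha R * (M%:R * eta_KL K L).
  have c0 : 0 < alpha R * eta_KL K L by rewrite mulr_gt0.
  by rewrite mulrCA -[leLHS](mulVf (lt0r_neq0 c0)) ler_pM2r.
have : e ^+ 2 < M%:R * eta_KL K L.
  rewrite -(ltr_pM2l a0) (lt_le_trans ae)//.
rewrite -[ltRHS]lnK; last first.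
  by rewrite posrE -(pmulr_rgt0 _ a0) (lt_le_trans _ M1).
by rewrite /e -expRM_natl ltr_expR mulr1.
Qed.

Lemma mcdiarmid_exponent (R : realType) (N : nat) (delta e : R) : (0 < N)%N ->
  0 < delta < 1 -> Num.sqrt (2 / N%:R * ln (2 / delta)) * ln N%:R < e ->
  exists2 s, 0 <= s &
    expR (N%:R * (s ^+ 2 * (2 * ln N%:R / N%:R) ^+ 2 / 8) - s * e) < delta / 2.
Proof.
move=> N0 /andP[d0 d1] le.
have N0R : 0 < N%:R :> R by rewrite ltr0n.
have lnd : 0 < ln (2 / delta) by rewrite ln_gt0// ltr_pdivlMr// mul1r (lt_trans d1)// ltr1n.
have lnN : 0 <= ln (N%:R : R) by rewrite ln_ge0// ler1n.
set r := Num.sqrt _ in le; have r0 : 0 <= r := sqrtr_ge0 _.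
have r2 : r ^+ 2 = 2 / N%:R * ln (2 / delta) by rewrite sqr_sqrtr// mulr_ge0 ?divr_ge0 ?ltW.
have e0 : 0 < e by apply: le_lt_trans le; rewrite mulr_ge0.
have d2E : delta / 2 = expR (- ln (2 / delta)).
  by rewrite expRN lnK ?posrE ?divr_gt0// invf_div.
rewrite d2E.
move: lnN; rewrite le_eqVlt => /predU1P[lnN0|lnN].
  (* When [ln N = 0] the quadratic term vanishes, and any [s] with [s * e > ln (2 / delta)] will
     do. *)
  exists ((ln (2 / delta) + 1) / e); first by rewrite divr_ge0 ?addr_ge0 ?ltW.
  rewrite ltr_expR -lnN0 mulr0 mul0r expr0n/= mulr0 mul0r mulr0 sub0r ltrN2 divfK ?gt_eqF//.
  by rewrite ltrDl.
(* This is the minimizer of the exponent [s ^+ 2 * ln N ^+ 2 / (2 * N) - s * e]. *)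
exists (e * N%:R / ln N%:R ^+ 2); first by rewrite !mulr_ge0 ?invr_ge0 ?exprn_ge0 ?ltW.
rewrite ltr_expR.
have -> : N%:R * ((e * N%:R / ln N%:R ^+ 2) ^+ 2 * (2 * ln N%:R / N%:R) ^+ 2 / 8) -
    e * N%:R / ln N%:R ^+ 2 * e = - (e ^+ 2 * (N%:R / (2 * ln N%:R ^+ 2))).
  by field; rewrite !gt_eqF.
rewrite ltrN2 mulrA ltr_pdivlMr ?mulr_gt0 ?exprn_gt0//.
have h : (r * ln N%:R) ^+ 2 < e ^+ 2.
  by rewrite ltr_sqr ?nnegrE ?mulr_ge0 ?(ltW lnN) ?(ltW e0).
rewrite exprMn r2 in h.
rewrite -(ltr_pM2r N0R) in h; apply: le_lt_trans h; rewrite le_eqVlt; apply/orP; left.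
by apply/eqP; field; rewrite gt_eqF.
Qed.

(** Union bound over the two tails. The slack [g] puts the threshold strictly above the square-root
    term, so that each tail is strictly below [delta / 2]. *)
Lemma plugin_entropy_concentration (R : realType) (J : finType) (q : J -> R) (N : nat)
  (delta g : R) : (forall j, 0 <= q j) -> \sum_j q j = 1 -> (0 < N)%N -> 0 < delta < 1 ->
  0 < g ->
  1 - delta < iid_mean q N (fun t =>
    (`|plugin_entropy R N t - iid_mean q N (plugin_entropy R N)| <
     Num.sqrt (2 / N%:R * ln (2 / delta)) * ln N%:R + g)%R%:R).
Proof.
move=> q0 q1 N0 d01 g0; set f := plugin_entropy R N; set m := iid_mean q N f.
set r := Num.sqrt _ * _; have rg : r < r + g by rewrite ltrDl.
have [s s0 sd] := mcdiarmid_exponent N0 d01 rg.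
have fc : bounded_differences N (2 * ln N%:R / N%:R) f.
  exact: plugin_entropy_bounded_differences.
have hu := le_lt_trans (mcdiarmid_upper q0 q1 (r + g) s0 fc) sd.
have hl := le_lt_trans (mcdiarmid_lower q0 q1 (r + g) s0 fc) sd.
have : 1 <= iid_mean q N (fun t => (`|f t - m| < r + g)%R%:R) +
    (iid_mean q N (fun t => (r + g <= f t - m)%R%:R) +
     iid_mean q N (fun t => (r + g <= m - f t)%R%:R)).
  rewrite -!iid_meanD -[leLHS](iid_mean_cst q1 N); apply: le_iid_mean => // t _.
  case: (ltP `|f t - m|) => [_|]; first by rewrite lerDl addr_ge0.
  rewrite add0r ler_normr opprB.
  by case/orP => ->; rewrite ?lerDl ?lerDr.
rewrite -/f -/m in hu hl; lra.
Qed.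

(** Passage from finite sequences of cells to [P]: the events [A t] are disjoint, and by
    independence have the product weights. Only an inequality is claimed, since [E] may also contain
    outcomes with a sample outside every cell. *)
Lemma probability_cells_ge (R : realType) (d : measure_display) (T : measurableType d)
  (P : probability T R) (K N M : nat) (x : T -> K.-tuple R) (X : 'I_N -> T -> K.-tuple R)
  (good : pred (seq {ffun 'I_K -> 'I_M})) (E : set T) :
  measurable_fun setT x -> (forall i, measurable_fun setT (X i)) ->
  (forall i (A : set (K.-tuple R)), measurable A -> P (X i @^-1` A) = P (x @^-1` A)) ->
  mutually_independent P X ->
  measurable E ->
  (forall w (t : N.-tuple {ffun 'I_K -> 'I_M}), good t ->
     (forall i, cell (tnth t i) (X i w)) -> E w) ->
  ((iid_mean (fun j : {ffun 'I_K -> 'I_M} => fine (P (x @^-1` cell j))) N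
     (fun s => (good s)%:R))%:E <= P E)%E.
Proof.
move=> mx mX Xx indep mE goodE.
pose A (t : N.-tuple {ffun 'I_K -> 'I_M}) : set T :=
  \bigcap_(i in [set: 'I_N]) (X i @^-1` cell (tnth t i)).
have mpre (Y : T -> K.-tuple R) j : measurable_fun setT Y -> measurable (Y @^-1` @cell R K M j).
  by move=> mY; rewrite -[X in measurable X]setTI; apply: mY => //; exact: measurable_cell.
have mA t : measurable (A t).
  by apply: fin_bigcap_measurable => [|i _]; [exact: finite_finset|exact: mpre].
have PA t : P (A t) = (\prod_(j <- t) fine (P (x @^-1` cell j)))%:E.
  rewrite indep => [|i]; last exact: measurable_cell.
  rewrite big_tuple -prodEFin; apply: eq_bigr => i _.
  rewrite Xx ?fineK//; last exact: measurable_cell.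
  by rewrite fin_num_measure//; exact: mpre.
have tA : trivIset [set: N.-tuple {ffun 'I_K -> 'I_M}] A.
  apply/trivIsetP => s t _ _ /eqP st; apply/disjoints_subset => w As At; apply: st.
  by apply: eq_from_tnth => i; apply: cell_inj (As i I) (At i I).
have subE : \bigcup_(t in [set t : N.-tuple _ | good t]) A t `<=` E.
  by move=> w [t gt At]; apply: (goodE w t) => // i; exact: At.
have mU : measurable (\bigcup_(t in [set t : N.-tuple _ | good t]) A t).
  by apply: fin_bigcup_measurable => //; exact: finite_finset.
apply: (@le_trans _ _ (P (\bigcup_(t in [set t : N.-tuple _ | good t]) A t))); last first.
  by apply: le_measure => //; rewrite inE.
rewrite measure_fin_bigcup//=; last by move=> s t _ _; apply: tA.
rewrite (eq_fsbigr (fun t : N.-tuple _ => (\prod_(j <- t) fine (P (x @^-1` cell j)))%:E)); last first.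
  by move=> t _; exact: PA.
rewrite (_ : [set t : N.-tuple _ | good t] =
    [set` [seq t : N.-tuple _ <- index_enum _ | good t]]); last first.
  by apply/seteqP; split=> t /=; rewrite mem_filter mem_index_enum andbT.
rewrite -fsbig_seq ?filter_uniq ?index_enum_uniq//.
rewrite big_filter sumEFin lee_fin le_eqVlt; apply/orP; left; apply/eqP.
rewrite [RHS]big_mkcond; apply: eq_bigr => t _.
by case: (good t); rewrite ?mulr1 ?mulr0.
Qed.

Theorem theorem2 (R : realType) (d : measure_display) (T : measurableType d)
  (P : probability T R) (K N M : nat) (L delta : R)
  (p : K.-tuple R -> R) (x : T -> K.-tuple R) (X : 'I_N -> T -> K.-tuple R) :
  (0 < K)%N -> 0 < L -> (0 < N)%N ->
  measurable_fun setT x ->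
  is_density P x p ->
  P (x @^-1` unit_cube K) = 1%E ->
  (forall s t, `|p s - p t| <= L * l1dist s t) ->
  (forall i, measurable_fun setT (X i)) ->
  (forall i (A : set (K.-tuple R)), measurable A ->
      P (X i @^-1` A) = P (x @^-1` A)) ->
  mutually_independent P X ->
  M%:R >= (alpha R * eta_KL K L)^-1 ->
  0 < delta < 1 ->
  ((1 - delta)%:E <
   P [set w | (`| (hhat M (fun i => X i w))%:E - diff_entropy p | <=
       (L * K%:R / (2 * M%:R) * ln (M%:R * eta_KL K L)
        + Num.sqrt (2 / N%:R * ln (2 / delta)) * ln N%:R
        + ln (1 + (M%:R ^+ K - 1) / N%:R))%:E)%E])%E.
Proof.
move=> K0 L0 N0 mx dens Pcube pL mX Xx indep leM d01.
have lnM := alpha_eta_ln_gt2 K0 L0 leM.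
have M0 : (0 < M)%N.
  (* For [M = 0] the logarithm takes its default value 0, which is not above 2. *)
  rewrite lt0n; apply/eqP => M0; move: lnM.
  by rewrite M0 mul0r ln0// ltNge ler0n.
have M0R : 0 < M%:R :> R by rewrite ltr0n.
have [mu [ge0int bint mubox]] := lebK_int_measure R K.
pose q (j : {ffun 'I_K -> 'I_M}) := fine (P (x @^-1` cell j)).
have q0 j : 0 <= q j by exact: fine_ge0.
pose HQ := - \sum_j q j * ln (q j).
have [q1 [H -> /andP[H1 H2]]] : \sum_j q j = 1 /\ exists2 H, diff_entropy p = H%:E &
    HQ - K%:R * ln M%:R - L * K%:R / M%:R <= H <= HQ - K%:R * ln M%:R.
  exact: (quantized_entropy_bounds L0 mx dens Pcube pL ge0int bint mubox K0 M0).
set b := L * K%:R / (2 * M%:R).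
have b0 : 0 < b by rewrite divr_gt0 ?mulr_gt0 ?ltr0n.
have b2 : L * K%:R / M%:R = b * 2 by rewrite /b; field; rewrite gt_eqF.
set B := b * _; set r := Num.sqrt _ * _.
(* The slack: the quantization error is at most [2 * b], while the statement allows
   [B = b * ln (M * eta)] with a logarithm above 2. *)
have g0 : 0 < B - b * 2 by rewrite subr_gt0 ltr_pM2l.
have card_cells : #|{ffun 'I_K -> 'I_M}|%:R = M%:R ^+ K :> R.
  by rewrite card_ffun !card_ord natrX.
have Hle := plugin_entropy_mean_le q0 q1 N0.
have Hge := plugin_entropy_mean_ge q0 q1 N0.
rewrite card_cells in Hge.
have c0 : 0 <= ln (1 + (M%:R ^+ K - 1) / N%:R : R).
  by rewrite ln_ge0// lerDl divr_ge0// subr_ge0 exprn_ege1// ler1n.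
set c := ln (1 + _) in Hge c0 *.
set m := iid_mean q N (plugin_entropy R N) in Hle Hge; rewrite -/HQ in Hle Hge.
set E := [set w | _].
have EE : E = (fun w => hhat M (fun i => X i w)) @^-1`
    `[H - (B + r + c), H + (B + r + c)]%classic.
  by apply/seteqP; split=> w; rewrite /E /= in_itv/= lee_fin ler_distl.
have mE : measurable E.
  rewrite EE -[X in measurable X]setTI; apply: measurable_hhat => //.
apply: lt_le_trans (probability_cells_ge
  (good := fun t => `|plugin_entropy R N t - m| < r + (B - b * 2)) mx mX Xx indep mE _).
  by rewrite lte_fin; exact: plugin_entropy_concentration.
(* From above, the fluctuation [r + (B - 2 * b)] and the quantization error [2 * b] add up to
   [r + B], the bias being nonpositive. From below, the quantization term is nonnegative and the
   bias costs at most [c]. *)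
move=> w t tm tX; rewrite EE /= in_itv/= /hhat (emp_entropy_cells M0 tX).
move: tm; rewrite ltr_norml => /andP[m1 m2].
by rewrite b2 in H1; apply/andP; split; lra.
Qed.
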